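(* Let $N \geqslant 2$ be an integer, let $\mathcal{D} \subset \{0,1,\ldots,N-1\}^2$ be non-empty, and let $F=F(N,\mathcal{D})$ be the associated fractal square. Then the collection $\mathscr{C}(F)$ of all connected components of $F$ is either a finite or an uncountable set.
   Context: For an integer $N\geqslant 2$ and a non-empty $\mathcal{D} \subset \{0,1,\ldots,N-1\}^2$, put $\varphi_d(x)=(x+d)/N$ for $d\in\mathcal{D}$, $x\in\mathbb{R}^2$. The fractal square $F=F(N,\mathcal{D})$ is the unique non-empty compact set $F\subset\mathbb{R}^2$ with $F=\bigcup_{d\in\mathcal{D}}\varphi_d(F)$. *)

(* Defs.v *)
From mathcomp Require Import all_boot all_order all_algebra.
From mathcomp Require Import all_classical all_reals all_analysis.
Import Order.TTheory GRing.Theory Num.Theory.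
Import numFieldNormedType.Exports.

Set Implicit Arguments.
Unset Strict Implicit.
Unset Printing Implicit Defensive.

Local Open Scope classical_set_scope.
Local Open Scope ring_scope.

Definition fs_map (R : realType) (N : nat) (d : 'I_N * 'I_N) (x : R * R) :
    R * R :=
  ((x.1 + (d.1 : nat)%:R) / N%:R, (x.2 + (d.2 : nat)%:R) / N%:R).

(* For [2 <= N] and nonempty [D], exactly one set satisfies this predicate
   (the attractor of a contractive iterated function system). *)
Definition is_fractal_square (R : realType) (N : nat)
    (D : {set 'I_N * 'I_N}) (F : set (R * R)) : Prop :=
  [/\ F !=set0, compact F & F = \bigcup_(d in [set` D]) (fs_map d @` F)].

Definition components (T : topologicalType) (F : set T) : set (set T) :=
  [set connected_component F x | x in F].

(* Main.v *)
Require Import Defs.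
From mathcomp Require Import all_boot all_order all_algebra.
From mathcomp Require Import all_classical all_reals all_analysis.
Import numFieldNormedType.Exports.
From mathcomp Require Import zify ring lra.
Import Order.TTheory GRing.Theory Num.Theory.

Set Implicit Arguments.
Unset Strict Implicit.
Unset Printing Implicit Defensive.

(* Write F_n for the union of the level-n squares meeting F; the components of
   F are the limits of the components of the F_n. If there are only countably
   many, a diagonal argument yields a component E of some F_n on which F is
   connected, that is, a finite set E of cells with E + F connected. Leaving
   the extreme cells of E forces every component of F to join two opposite
   sides of the square, say left and right. By planarity at most one component
   then touches the top side. Divide F into the cells of level n. A component of
   F which meets the top side of no cell stays in a single full row of cells;
   translated to the bottom row of E, it is closed in the connected set E + F,
   so it contains a whole cell of F. This bounds the number of components. *)

(** * King walks in the grid and planarity *)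

Definition cell : Type := (nat * nat)%type.

(** Equivalently, the closed unit squares at [p] and [q] meet; successors avoid truncated
    subtraction. *)
Definition adj (p q : cell) : bool :=
  [&& p.1 <= q.1.+1, q.1 <= p.1.+1, p.2 <= q.2.+1 & q.2 <= p.2.+1].

Inductive conn (S : pred cell) (p : cell) : cell -> Prop :=
| conn_refl : S p -> conn S p p
| conn_step q r : conn S p q -> S r -> adj q r -> conn S p r.

Lemma adj_sym p q : adj p q = adj q p.
Proof. by rewrite /adj; lia. Qed.

Lemma adj_refl p : adj p p.
Proof. by rewrite /adj; lia. Qed.

Lemma conn_src (S : pred cell) p q : conn S p q -> S p.
Proof. by elim. Qed.

Lemma conn_tgt (S : pred cell) p q : conn S p q -> S q.
Proof. by case. Qed.

Lemma conn_trans S q p r : conn S p q -> conn S q r -> conn S p r.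
Proof. by move=> pq; elim=> // a b _ pa Sb; apply: conn_step pa Sb. Qed.

Lemma conn_adj (S : pred cell) p q : S p -> S q -> adj p q -> conn S p q.
Proof. by move=> Sp; apply: conn_step (conn_refl Sp). Qed.

Lemma conn_sym S p q : conn S p q -> conn S q p.
Proof.
elim=> [|a b pa ap Sb ab]; first exact: conn_refl.
apply: conn_trans ap; apply: conn_adj => //; first exact: conn_tgt pa.
by rewrite adj_sym.
Qed.

Lemma conn_map (S T : pred cell) (f : cell -> cell) :
  (forall p, S p -> T (f p)) ->
  (forall p q, S p -> S q -> adj p q -> adj (f p) (f q)) ->
  forall p q, conn S p q -> conn T (f p) (f q).
Proof.
move=> fS fadj p q; elim=> [|a b pa Ta Sb ab]; first by move/fS/conn_refl.
by apply: conn_step Ta (fS _ Sb) (fadj _ _ (conn_tgt pa) Sb ab).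
Qed.

(** With columns at most one apart, non-adjacent cells differ by at least two rows; the two steps
    change this difference by at most two, so its sign persists. *)
Lemma same_side a b p q : adj a b -> adj p q -> ~~ adj a p -> ~~ adj b q ->
  a.1 <= p.1.+1 -> p.1 <= a.1.+1 -> b.1 <= q.1.+1 -> q.1 <= b.1.+1 ->
  (p.2 < a.2) = (q.2 < b.2).
Proof.
rewrite /adj => /and4P[_ _ ab1 ab2] /and4P[_ _ pq1 pq2] + + h1 h2 h3 h4.
by rewrite h1 h2 h3 h4 /=; lia.
Qed.

(* [u q] is the parity of the number of steps of a walk from [x] to [y] that
   enter or leave the column of [q] through its left side, above [q]. *)
Lemma crossing_parity (S : pred cell) x y : conn S x y -> exists u : cell -> bool,
  [/\ forall q q', (forall p, S p -> ~~ adj p q /\ ~~ adj p q') ->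
        adj q q' -> q'.1 = q.1.+1 ->
        u q (+) u q' = ((x.1 == q.1) && (q.2 < x.2))
                       (+) ((y.1 == q.1) && (q.2 < y.2)),
      forall q q', (forall p, S p -> ~~ adj p q /\ ~~ adj p q') ->
        adj q q' -> q'.1 = q.1 -> u q = u q' &
      forall q, q.1 = 0 \/ (forall p, S p -> p.2 <= q.2) \/
                (forall p, S p -> p.1 < q.1) -> u q = false].
Proof.
elim=> [Sx|y1 y2 xy1 [u [uh uv u0]] Sy2 y12].
  by exists (fun=> false); split=> // *; rewrite !addbb.
have Sy1 := conn_tgt xy1.
pose cr (q : cell) := [&& y1.1.+1 == q.1, y2.1 == q.1 & q.2 < y2.2] ||
              [&& y2.1.+1 == q.1, y1.1 == q.1 & q.2 < y1.2].
exists (fun q => u q (+) cr q); split.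
- move=> q q' far qq' e.
  (* [cr q] and [cr q'] record crossings of the left and right side of the column of [q]. By
     [same_side], one end of a step to the right lies above [q'] exactly when the other lies above
     [q], so the sum tells whether the step enters or leaves the column above [q]. *)
  suff E : cr q (+) cr q' = ((y1.1 == q.1) && (q.2 < y1.2))
                            (+) ((y2.1 == q.1) && (q.2 < y2.2)).
    by rewrite addbACA uh // E -addbA addKb.
  have [[f1 f1'] [f2 f2']] := (far _ Sy1, far _ Sy2).
  have [s1 s2] : y1.1 <= y2.1.+1 /\ y2.1 <= y1.1.+1.
    by move: y12; rewrite /adj => /and4P[].
  have y21 : adj y2 y1 by rewrite adj_sym.
  rewrite /cr e; case: (eqVneq y1.1 q.1) => c1; case: (eqVneq y2.1 q.1) => c2 /=.
  + rewrite (same_side y12 (adj_refl q) f1 f2) ?c1 ?c2 //.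
    by rewrite !eqn_leq !ltnn !andbF /= addbb.
  + have [d|d] : y2.1.+1 = q.1 \/ y2.1 = q.1.+1 by lia.
      by rewrite c1 d !eqxx; lia.
    rewrite (same_side y12 qq' f1 f2') ?c1 ?d ?e // eqxx /=; lia.
  + have [d|d] : y1.1.+1 = q.1 \/ y1.1 = q.1.+1 by lia.
      by rewrite c2 d !eqxx; lia.
    rewrite (same_side y21 qq' f2 f1') ?c2 ?d ?e // eqxx /=; lia.
  + lia.
- move=> q q' far qq' e; rewrite (uv q q' far qq' e); congr (_ (+) _).
  have [[f1 f1'] [f2 f2']] := (far _ Sy1, far _ Sy2).
  have [s1 s2] : y1.1 <= y2.1.+1 /\ y2.1 <= y1.1.+1.
    by move: y12; rewrite /adj => /and4P[].
  rewrite /cr e; congr (_ || _).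
  + case: eqP => //= h1; case: eqP => //= h2.
    by apply: same_side (adj_refl _) qq' f2 f2' _ _ _ _; rewrite ?e h2.
  + case: eqP => //= h1; case: eqP => //= h2.
    by apply: same_side (adj_refl _) qq' f1 f1' _ _ _ _; rewrite ?e h2.
- move=> q h; rewrite (u0 q h) /= /cr.
  case: h => [->|h]; first by [].
  suff [-> ->] : ((y1.1 == q.1) && (q.2 < y1.2)) = false /\
      ((y2.1 == q.1) && (q.2 < y2.2)) = false by rewrite !andbF.
  by case: h => h; have := h _ Sy1; have := h _ Sy2; lia.
Qed.

(** When [q] moves one column to the right, [x] contributes nothing, being in the bottom row or the
    last column, and [y], in the top row, contributes exactly the change of [y.1 < q.1]. *)
Lemma parity_invariant (S : pred cell) (x y : cell) (u : cell -> bool) M :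
  (forall q q', (forall p, S p -> ~~ adj p q /\ ~~ adj p q') ->
        adj q q' -> q'.1 = q.1.+1 ->
        u q (+) u q' = ((x.1 == q.1) && (q.2 < x.2))
                       (+) ((y.1 == q.1) && (q.2 < y.2))) ->
  (forall q q', (forall p, S p -> ~~ adj p q /\ ~~ adj p q') ->
        adj q q' -> q'.1 = q.1 -> u q = u q') ->
  S y -> y.2 = M.-1 ->
  x.2 = 0 \/ x.1 = M.-1 ->
  forall q q', (forall p, S p -> ~~ adj p q /\ ~~ adj p q') ->
  adj q q' -> q.2 < M -> q'.2 < M -> q.1 < M -> q'.1 < M ->
  u q (+) (y.1 < q.1) = u q' (+) (y.1 < q'.1).
Proof.
move=> uh uv Sy yT xB.
suff H q q' : (forall p, S p -> ~~ adj p q /\ ~~ adj p q') ->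
    adj q q' -> q.2 < M -> q'.2 < M -> q.1 < M -> q'.1 < M -> q'.1 = q.1.+1 ->
    u q (+) (y.1 < q.1) = u q' (+) (y.1 < q'.1).
  move=> q q' far qq' qM2 q'M2 qM q'M.
  have : q'.1 = q.1 \/ q'.1 = q.1.+1 \/ q.1 = q'.1.+1 by move: qq'; rewrite /adj; lia.
  case=> [e|[e|e]]; first by rewrite (uv q q') // e.
    exact: H.
  symmetry; apply: H => //; last by rewrite adj_sym.
  by move=> p /far [].
move=> far qq' qM2 q'M2 qM q'M e.
have := uh q q' far qq' e; have [n1 n2] := far _ Sy.
have -> : ((x.1 == q.1) && (q.2 < x.2)) = false by case: xB; lia.
have -> : (y.1 == q.1) && (q.2 < y.2) = (y.1 == q.1) by move: n1; rewrite /adj; lia.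
rewrite addFb; case: (u q); case: (u q') => /=; lia.
Qed.

(* The endpoints of the two walks lie on the boundary of the box and alternate
   along it. *)
Lemma walks_meet (S T : pred cell) (x y q q' : cell) M :
  (forall p, S p -> p.1 < M /\ p.2 < M) -> (forall p, T p -> p.1 < M /\ p.2 < M) ->
  conn S x y -> conn T q q' -> y.2 = M.-1 ->
  (x.2 = 0 /\ q.1 = 0 /\ q'.1 = M.-1) \/
  (x.1 = M.-1 /\ q.1 = 0 /\ q'.2 = M.-1 /\ y.1 < q'.1) ->
  exists a b, [/\ S a, T b & adj a b].
Proof.
move=> SM TM xy qq' yT hx; apply: contrapT => nomeet.
have far a b : S a -> T b -> ~~ adj a b.
  by move=> Sa Tb; apply/negP => ab; apply: nomeet; exists a, b.
have [u [uh uv u0]] := crossing_parity xy.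
have Sy := conn_tgt xy.
have inv := parity_invariant uh uv Sy yT.
have xB : x.2 = 0 \/ x.1 = M.-1 by case: hx => -[]; tauto.
(* The invariant is carried along the second walk; at [q], in the first column, it is false. *)
have uq : u q (+) (y.1 < q.1) = u q' (+) (y.1 < q'.1).
  elim: qq' => // a b qa -> Tb ab.
  have [[? ?] [? ?]] := (TM _ (conn_tgt qa), TM _ Tb).
  by apply: (inv xB) => // p Sp; split; apply: far => //; exact: conn_tgt qa.
have q0 : q.1 = 0 by case: hx => -[_ []].
have nadj := far _ _ Sy (conn_tgt qq'); have [y1 y2] := SM _ Sy.
have [z1 z2] := TM _ (conn_tgt qq').
move: uq; rewrite (u0 q) ?q0 //; last by left.
case: hx => [[x0 [_ qR]]|[xR [_ [qT yq]]]].
  (* one more step to the right takes the second walk out of the box *)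
  have e : u q' (+) u (q'.1.+1, q'.2) = (y.1 == q'.1).
    rewrite uh //=; last by rewrite /adj /=; lia.
      by move: nadj; rewrite /adj; lia.
    move=> p Sp; have := far _ _ Sp (conn_tgt qq'); have := SM _ Sp.
    by rewrite /adj /=; lia.
  have : u (q'.1.+1, q'.2) = false.
    by apply: u0; right; right => p /SM /=; lia.
  by move: e; case: (u q'); case: (u _) => //=; lia.
(* [q'] lies in the top row, so no step passes above it. *)
have -> : u q' = false; last by rewrite yq.
by apply: u0; right; left => p /SM; lia.
Qed.

(** * Cells of level n *)

Definition blk (M : nat) (p : cell) : cell := (p.1 %/ M, p.2 %/ M).
Definition loc (M : nat) (p : cell) : cell := (p.1 %% M, p.2 %% M).
Definition glue (M : nat) (e r : cell) : cell := (e.1 * M + r.1, e.2 * M + r.2).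
Definition transpose (p : cell) : cell := (p.2, p.1).

(* The cells of [N E + D], for [D] within [0, N)^2. *)
Definition inflate (N : nat) (E D : pred cell) (p : cell) : bool :=
  E (blk N p) && D (loc N p).

(* [p] in [level N D n] stands for the square [N^-n (p + [0,1]^2)]. *)
Fixpoint level (N : nat) (D : pred cell) (n : nat) : pred cell :=
  if n is n'.+1 then inflate N (level N D n') D else pred1 (0, 0).

Definition inbox (M : nat) (S : pred cell) := forall p, S p -> p.1 < M /\ p.2 < M.

Lemma glueK M p : glue M (blk M p) (loc M p) = p.
Proof. by case: p => a b; rewrite /glue /= -!divn_eq. Qed.

Lemma blk_glue M e r : r.1 < M -> r.2 < M -> blk M (glue M e r) = e.
Proof.
case: e r => [a b] [c d] /= h1 h2; have M0 : 0 < M by lia.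
by rewrite /blk /= !divnMDl // !divn_small // !addn0.
Qed.

Lemma loc_glue M e r : r.1 < M -> r.2 < M -> loc M (glue M e r) = r.
Proof.
by case: e r => [a b] [c d] /= h1 h2; rewrite /loc /= !modnMDl !modn_small.
Qed.

Lemma adj_glue M e r r' : adj (glue M e r) (glue M e r') = adj r r'.
Proof. by rewrite /adj /= -!addnS !leq_add2l. Qed.

Lemma leq_div_succ M a b : a <= b.+1 -> a %/ M <= (b %/ M).+1.
Proof.
case: M => [|M] h; first by rewrite !divn0.
rewrite -[(b %/ _).+1]add1n -divnMDl // leq_div2r //; lia.
Qed.

Lemma adj_blk M p q : adj p q -> adj (blk M p) (blk M q).
Proof. by move=> /and4P[? ? ? ?]; apply/and4P; split; apply: leq_div_succ. Qed.

Section Levels.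
Variables (N : nat) (D : pred cell).
Hypothesis N1 : 1 < N.
Notation L := (level N D).

Lemma expN_gt0 j : 0 < N ^ j.
Proof. by rewrite expn_gt0; lia. Qed.

Lemma loc_lt j p : (loc (N ^ j) p).1 < N ^ j /\ (loc (N ^ j) p).2 < N ^ j.
Proof. by rewrite !ltn_pmod ?expN_gt0. Qed.

Lemma inflate_level0 (E : pred cell) : inflate (N ^ 0) E (L 0) =1 E.
Proof.
by case=> a b; rewrite /inflate /blk /loc /= expn0 !divn1 !modn1 eqxx andbT.
Qed.

Lemma inflate_levelS (E : pred cell) j :
  inflate (N ^ j.+1) E (L j.+1) =1 inflate N (inflate (N ^ j) E (L j)) D.
Proof.
case=> a b; rewrite /inflate /= /inflate /blk /loc /= !andbA expnS !divnMA.
by rewrite mulnC -!modn_divl !modn_dvdm ?dvdn_mull.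
Qed.

Lemma levelD m j : L (m + j) =1 inflate (N ^ j) (L m) (L j).
Proof.
elim: j => [|j IH] p; first by rewrite addn0 inflate_level0.
by rewrite addnS inflate_levelS /= /inflate IH.
Qed.

Lemma level_inbox n : inbox (N ^ n) (L n).
Proof.
elim: n => [|n IH] p /=; first by move=> /eqP ->.
case/andP => /IH [/= h1 h2] _; rewrite expnSr.
by rewrite -!ltn_divLR //; lia.
Qed.

Lemma glue_inflate j (E : pred cell) e r : E e -> L j r ->
  inflate (N ^ j) E (L j) (glue (N ^ j) e r).
Proof.
move=> Ee Lr; have [h1 h2] := level_inbox Lr.
by rewrite /inflate blk_glue // loc_glue // Ee.
Qed.

Lemma conn_glue j (E : pred cell) e r r' : E e -> conn (L j) r r' ->
  conn (inflate (N ^ j) E (L j)) (glue (N ^ j) e r) (glue (N ^ j) e r').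
Proof.
move=> Ee; apply: conn_map => [p|p q _ _]; first exact: glue_inflate.
by rewrite adj_glue.
Qed.

Lemma conn_eq (S T : pred cell) p q : S =1 T -> conn S p q -> conn T p q.
Proof. by move=> ST; apply: (@conn_map S T id) => // x; rewrite ST. Qed.

Lemma conn_blk j (E : pred cell) p q : conn (inflate (N ^ j) E (L j)) p q ->
  conn E (blk (N ^ j) p) (blk (N ^ j) q).
Proof. by apply: conn_map => [x /andP[]|x y _ _ /adj_blk]. Qed.

End Levels.

Lemma level_transpose N D n p :
  level N (D \o transpose) n p = level N D n (transpose p).
Proof.
elim: n p => [|n IH] [a b] /=; first by rewrite /transpose /= !xpair_eqE andbC.
by rewrite /inflate IH.
Qed.

Lemma conn_transpose (S : pred cell) p q :
  conn S p q -> conn (S \o transpose) (transpose p) (transpose q).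
Proof.
apply: conn_map => [[a b] //|[a b] [c d] _ _].
by move=> /and4P[? ? ? ?]; apply/and4P.
Qed.

(** * The combinatorial bound *)

Definition conn_class (S : pred cell) (p : cell) : pred cell :=
  fun q => `[< conn S p q >].

Lemma conn_in_class (S : pred cell) p a b :
  conn S p a -> conn S p b -> conn (conn_class S p) a b.
Proof.
have H c : conn S p c -> conn (conn_class S p) p c.
  elim=> [Sp|x y px IH Sy xy]; first by apply/conn_refl/asboolP/conn_refl.
  by apply: (conn_step IH _ xy); apply/asboolP; apply: conn_step px Sy xy.
by move=> /H pa /H pb; apply: conn_trans pb; apply: conn_sym.
Qed.

Definition hcross (M : nat) (S : pred cell) (p : cell) :=
  exists a b, [/\ conn S p a, conn S p b, a.1 = 0 & b.1 = M.-1].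
Definition vcross (M : nat) (S : pred cell) (p : cell) :=
  exists a b, [/\ conn S p a, conn S p b, a.2 = 0 & b.2 = M.-1].

(** Applied to the classes of [p] and [q] instead of [S], [walks_meet] gives adjacent cells, one in
    each class, so the classes coincide. *)
Lemma conn_cross (S : pred cell) M (p q x y a b : cell) : inbox M S ->
  conn S p x -> conn S p y -> conn S q a -> conn S q b -> y.2 = M.-1 ->
  (x.2 = 0 /\ a.1 = 0 /\ b.1 = M.-1) \/
  (x.1 = M.-1 /\ a.1 = 0 /\ b.2 = M.-1 /\ y.1 < b.1) ->
  conn S p q.
Proof.
move=> SM px py qa qb yT h.
have box z : inbox M (conn_class S z) by move=> c /asboolP /conn_tgt /SM.
have [c [d [/asboolP pc /asboolP qd cd]]] :=
  walks_meet (box p) (box q) (conn_in_class px py) (conn_in_class qa qb) yT h.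
apply: conn_trans (conn_sym qd); apply: conn_step pc _ cd; exact: conn_tgt qd.
Qed.

Lemma hvcross_conn (S : pred cell) M p q : inbox M S ->
  hcross M S p -> vcross M S q -> conn S p q.
Proof.
move=> SM [a [b [pa pb aL bR]]] [x [y [qx qy xB yT]]].
by apply/conn_sym/(conn_cross SM qx qy pa pb yT); left.
Qed.

(** For [a] to the left of [b] in the top row, a walk from [a] to the right side and one from [b] to
    the left side have alternating ends, so they meet. *)
Lemma top_conn (S : pred cell) M p q : inbox M S ->
  (forall r, S r -> hcross M S r) -> S p -> S q -> p.2 = M.-1 -> q.2 = M.-1 ->
  conn S p q.
Proof.
move=> SM allH.
suff H (a b : cell) : S a -> S b -> a.2 = M.-1 -> b.2 = M.-1 -> a.1 < b.1 -> conn S a b.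
  move=> Sp Sq pT qT; case: (ltngtP p.1 q.1) => pq; first exact: H.
    by apply/conn_sym/H.
  have -> : p = q by case: p q pT qT pq {Sp Sq} => [? ?] [? ?] /= -> -> ->.
  exact: conn_refl.
move=> Sa Sb aT bT ab.
have [x [y [ax ay xL yR]]] := allH _ Sa; have [z [w [bz bw zL wR]]] := allH _ Sb.
by apply: (conn_cross SM ay (conn_refl Sa) bz (conn_refl Sb) aT); right.
Qed.

Lemma exists_min (E : pred cell) (f : cell -> nat) : (exists e, E e) ->
  exists2 e, E e & forall e', E e' -> f e <= f e'.
Proof.
case=> e0 Ee0.
have ex : exists k, `[< exists2 e, E e & f e = k >].
  by exists (f e0); apply/asboolP; exists e0.
case: (ex_minnP ex) => k /asboolP [e Ee <-] kmin; exists e => // e' Ee'.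
by apply: kmin; apply/asboolP; exists e'.
Qed.

Lemma exists_lexmin (E : pred cell) (f g : cell -> nat) : (exists e, E e) ->
  exists2 e, E e &
    forall e', E e' -> f e < f e' \/ (f e = f e' /\ g e <= g e').
Proof.
move=> /(exists_min f) [e Ee fe].
have [|e1 /andP[Ee1 /eqP fe1] ge1] := @exists_min (fun z => E z && (f z == f e)) g.
  by exists e; rewrite Ee eqxx.
exists e1 => // e' Ee'; rewrite fe1; have := fe _ Ee'.
rewrite leq_eqVlt => /orP[/eqP h|]; last by left.
by right; split=> //; apply: ge1; rewrite Ee' h eqxx.
Qed.

Lemma step_up M x a y b : a < M -> x < y -> y * M + b <= (x * M + a).+1 ->
  a = M.-1.
Proof. nia. Qed.

Lemma step_down M x a y b : b < M -> y < x -> x * M + a <= (y * M + b).+1 ->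
  a = 0.
Proof. nia. Qed.

(** * Every component of a level joins two opposite sides *)

Section Escape.
Variables (N : nat) (D : pred cell) (E : pred cell).
Hypothesis N1 : 1 < N.
Hypothesis Econn : forall j p q,
  inflate (N ^ j) E (level N D j) p -> inflate (N ^ j) E (level N D j) q ->
  conn (inflate (N ^ j) E (level N D j)) p q.
Notation L := (level N D).

(* A component of the block over [e] which does not reach a neighbouring block
   would be a component of the connected set [N^j E + D_j]. *)
Lemma escape (W : pred cell) e e1 j r : E e -> E e1 -> e1 <> e -> L j r ->
  (forall a b e', L j a -> L j b -> E e' -> e' <> e ->
    adj (glue (N ^ j) e a) (glue (N ^ j) e' b) -> W a) ->
  exists2 r', conn (L j) r r' & W r'.
Proof.
set M := N ^ j => Ee Ee1 ne1 Lr hW; apply: contrapT => noW.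
have stay c : conn (inflate M E (L j)) (glue M e r) c ->
    blk M c = e /\ conn (L j) r (loc M c).
  have [r1 r2] := level_inbox N1 Lr.
  elim=> [_|x y _ [xe rx] /andP[Ey Ly] xy].
    by rewrite blk_glue // loc_glue //; split=> //; apply: conn_refl.
  have [ye|/eqP ye] := eqVneq (blk M y) e; last first.
    case: noW; exists (loc M x) => //.
    by apply: hW (conn_tgt rx) Ly Ey ye _; rewrite -{1}xe !glueK.
  split=> //; apply: conn_step rx Ly _.
  by rewrite -(adj_glue M e) -{1}xe -ye !glueK.
have [r1 r2] := level_inbox N1 Lr.
have := stay (glue M e1 r); rewrite blk_glue // => h.
by case: h => //; apply: Econn; apply: glue_inflate.
Qed.

Hypothesis Emany : forall e, E e -> exists2 e', E e' & e' <> e.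
Hypothesis Ene : exists e, E e.

Variable K : nat.
Hypothesis EK : inbox K E.

(** Take a lexicographically extreme cell of [E], rows first: the other cells lie beyond its row, or
    in its row to one side, so by [escape] the component of [r] meets one of two adjacent sides of
    the square. The four extremes give all four pairs of adjacent sides, hence two opposite sides
    are met. *)
Lemma cross j r : L j r -> hcross (N ^ j) (L j) r \/ vcross (N ^ j) (L j) r.
Proof.
move=> Lr; set M := N ^ j.
have key (f g : cell -> nat) (W : pred cell) :
  (forall e e' a b : cell, e.1 < K /\ e.2 < K -> e'.1 < K /\ e'.2 < K ->
     ~ (e'.1 = e.1 /\ e'.2 = e.2) ->
     f e < f e' \/ (f e = f e' /\ g e <= g e') ->
     a.1 < M /\ a.2 < M -> b.1 < M /\ b.2 < M ->
     e.1 * M + a.1 <= (e'.1 * M + b.1).+1 -> e'.1 * M + b.1 <= (e.1 * M + a.1).+1 ->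
     e.2 * M + a.2 <= (e'.2 * M + b.2).+1 -> e'.2 * M + b.2 <= (e.2 * M + a.2).+1 ->
     W a) -> exists2 r', conn (L j) r r' & W r'.
  have [e Ee emin] := exists_lexmin f g Ene.
  move=> hW; have [e1 Ee1 ne1] := Emany Ee.
  apply: (escape Ee Ee1 ne1 Lr) => a b e' La Lb Ee' ne' /and4P[h1 h2 h3 h4].
  apply: (hW e e' a b (EK Ee) (EK Ee') _ (emin _ Ee')
    (level_inbox N1 La) (level_inbox N1 Lb)) => //.
  move=> [e1' e2']; apply: ne'; move: e1' e2'; clear.
  by case: e e' => [? ?] [? ?] /= -> ->.
have [x1 rx1 /orP c1] : exists2 r', conn (L j) r r' & (r'.1 == M.-1) || (r'.2 == M.-1).
  apply: (key snd fst) => e e' a b _ _ ne lt [a1 a2] [b1 b2] h1 h2 h3 h4.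
  have [d|d] : e.2 < e'.2 \/ e.1 < e'.1 by lia.
    by rewrite (step_up a2 d h4) eqxx orbT.
  by rewrite (step_up a1 d h2) eqxx.
have [x2 rx2 /orP c2] : exists2 r', conn (L j) r r' & (r'.1 == 0) || (r'.2 == M.-1).
  (* Coordinates in [E] are below [K], so minimizing [K - e.1] maximizes the column. *)
  apply: (key snd (fun e => K - e.1)) 
    => e e' a b [? ?] [? ?] ne lt [a1 a2] [b1 b2] h1 h2 h3 h4.
  have [d|d] : e.2 < e'.2 \/ e'.1 < e.1 by lia.
    by rewrite (step_up a2 d h4) eqxx orbT.
  by rewrite (step_down b1 d h1) eqxx.
have [x3 rx3 /orP c3] : exists2 r', conn (L j) r r' & (r'.1 == M.-1) || (r'.2 == 0).
  apply: (key (fun e => K - e.2) fst) 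
    => e e' a b [? ?] [? ?] ne lt [a1 a2] [b1 b2] h1 h2 h3 h4.
  have [d|d] : e'.2 < e.2 \/ e.1 < e'.1 by lia.
    by rewrite (step_down b2 d h3) eqxx orbT.
  by rewrite (step_up a1 d h2) eqxx.
have [x4 rx4 /orP c4] : exists2 r', conn (L j) r r' & (r'.1 == 0) || (r'.2 == 0).
  apply: (key (fun e => K - e.2) (fun e => K - e.1)) 
    => e e' a b [? ?] [? ?] ne lt [a1 a2] [b1 b2] h1 h2 h3 h4.
  have [d|d] : e'.2 < e.2 \/ e'.1 < e.1 by lia.
    by rewrite (step_down b2 d h3) eqxx orbT.
  by rewrite (step_down b1 d h1) eqxx.
have hl a b : conn (L j) r a -> conn (L j) r b -> a.1 == 0 -> b.1 == M.-1 ->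
    hcross M (L j) r \/ vcross M (L j) r.
  by move=> ? ? /eqP ? /eqP ?; left; exists a, b.
have vl a b : conn (L j) r a -> conn (L j) r b -> a.2 == 0 -> b.2 == M.-1 ->
    hcross M (L j) r \/ vcross M (L j) r.
  by move=> ? ? /eqP ? /eqP ?; right; exists a, b.
case: c1 c2 c3 c4 => c1 [] c2 [] c3 [] c4;
  solve [ exact: hl c2 c1 | exact: hl c4 c1 | exact: hl c2 c3 | exact: hl c4 c3
        | exact: vl c3 c1 | exact: vl c4 c1 | exact: vl c3 c2 | exact: vl c4 c2 ].
Qed.
End Escape.

(** * Counting components that join left and right *)

Section Core.
Variables (N : nat) (D : pred cell) (E : pred cell) (n : nat).
Hypothesis N1 : 1 < N.
Hypothesis Econn : forall j p q,
  inflate (N ^ j) E (level N D j) p -> inflate (N ^ j) E (level N D j) q ->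
  conn (inflate (N ^ j) E (level N D j)) p q.
Notation L := (level N D).
Hypothesis Emany : forall e, E e -> exists2 e', E e' & e' <> e.
Hypothesis Ene : exists e, E e.
Hypothesis EK : inbox (N ^ n) E.

(** By planarity a component joining bottom and top meets that of [p], hence equals it. *)
Lemma hcross_all j p : L j p -> hcross (N ^ j) (L j) p ->
  forall q, L j q -> hcross (N ^ j) (L j) q.
Proof.
move=> Lp hp q Lq; have [//|vq] := cross N1 Econn Emany Ene EK Lq.
have pq := hvcross_conn (@level_inbox N D N1 j) hp vq.
case: hp => a [b [pa pb aL bR]]; exists a, b; split=> //.
  exact: conn_trans (conn_sym pq) pa.
exact: conn_trans (conn_sym pq) pb.
Qed.

Lemma hcross_blk i j p : hcross (N ^ (i + j)) (L (i + j)) p ->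
  hcross (N ^ i) (L i) (blk (N ^ j) p).
Proof.
have cb x y : conn (L (i + j)) x y -> conn (L i) (blk (N ^ j) x) (blk (N ^ j) y).
  by move/(conn_eq (levelD N D i j))/conn_blk.
move=> [a [b [/cb pa /cb pb aL bR]]]; exists (blk (N ^ j) a), (blk (N ^ j) b).
split=> //=; first by rewrite aL div0n.
rewrite bR expnD; have := expN_gt0 N1 j; have := expN_gt0 N1 i; move: (N ^ i) (N ^ j).
move=> A B A0 B0; have -> : (A * B).-1 = A.-1 * B + B.-1 by nia.
by rewrite divnMDl // divn_small ?addn0 //; lia.
Qed.

(** A component that meets the top row of no block runs along one row of blocks. Copied into the
    bottom row of [E] it has no exit: moving up needs a top cell, nothing lies below, and the run of
    blocks ends in gaps. Connectedness of [inflate (N ^ j) E (L j)] then makes it fill a block. *)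
Lemma top_or_block j p :
  (forall q, L (n + j) q -> hcross (N ^ (n + j)) (L (n + j)) q) -> L (n + j) p ->
  exists2 e, L n e &
    (exists r, [/\ L j r, r.2 = (N ^ j).-1 & conn (L (n + j)) p (glue (N ^ j) e r)]) \/
    (forall r, L j r -> conn (L (n + j)) p (glue (N ^ j) e r)).
Proof.
set M := N ^ j; have M0 : 0 < M by exact: expN_gt0.
move=> allH Lp; apply: contrapT => none.
have LE := levelD N D n j.
have split_L c : L (n + j) c -> L n (blk M c) /\ L j (loc M c).
  by rewrite LE => /andP.
have notop c : conn (L (n + j)) p c -> (loc M c).2 <> M.-1.
  move=> pc top; apply: none; have [? ?] := split_L _ (conn_tgt pc).
  by exists (blk M c) => //; left; exists (loc M c); rewrite glueK.
have [a [z [pa pz aL zR]]] := allH _ Lp.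
have az : conn (L (n + j)) a z by apply: conn_trans pz; exact: conn_sym.
have noup c c' : adj c c' -> conn (L (n + j)) p c -> (blk M c).2 < (blk M c').2 -> False.
  move=> /and4P[_ _ _]; rewrite -{1}(glueK M c) -{1}(glueK M c') /= => h pc lt.
  by apply: (notop _ pc); apply: step_up lt h; case: (loc_lt N1 j c).
(* [noup] excludes upward block moves, and downward ones when applied to the reversed step. *)
have row c : conn (L (n + j)) a c -> (blk M c).2 = (blk M a).2.
  elim=> [//|x y ax <- Ly xy].
  have px := conn_trans pa ax; have py := conn_step px Ly xy.
  case: (ltngtP (blk M x).2 (blk M y).2) => // h; first by case: (noup x y).
  by case: (noup y x) => //; rewrite adj_sym.
set b := (blk M a).2 in row.
have ablk : blk M a = (0, b) by rewrite [LHS]surjective_pairing /= aL div0n.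
(* A step changes the block column by at most one, so a walk from the left side skips none. *)
have visit c : conn (L (n + j)) a c -> forall i, i <= (blk M c).1 -> L n (i, b).
  elim=> [La i|x y ax IH Ly xy i].
    rewrite ablk leqn0 => /eqP ->; rewrite -ablk; exact: (split_L _ La).1.
  have := adj_blk M xy => /and4P[_ h _ _].
  rewrite leq_eqVlt => /orP[/eqP ->|lt]; last by apply: IH; lia.
  rewrite -(row y) -?surjective_pairing; first exact: (split_L _ Ly).1.
  exact: conn_step ax Ly xy.
have full i : i < N ^ n -> L n (i, b).
  move=> iN; apply: (visit _ az); rewrite /= zR expnD -/M.
  have -> : (N ^ n * M).-1 = (N ^ n).-1 * M + M.-1 by nia.
  by rewrite divnMDl // divn_small ?addn0 //; lia.
(* Compare with the leftmost run of blocks, of length [k], in the bottom row of [E]. *)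
have [e Ee emin] := exists_lexmin snd fst Ene.
have exk : exists k, ~~ E (e.1 + k, e.2).
  by exists (N ^ n); apply/negP => /EK /=; lia.
case: (ex_minnP exk) => k kE kmin.
have [La Lra] := split_L _ (conn_tgt pa).
(* Invariant of walks from the copy of [a] in block [e]: they stay in the run, and moved back so
   that [e] becomes [(0, b)] they stay in the component of [a]. *)
have run c : conn (inflate M E (L j)) (glue M e (loc M a)) c ->
  [/\ (blk M c).2 = e.2, e.1 <= (blk M c).1, (blk M c).1 < e.1 + k &
      conn (L (n + j)) a (glue M ((blk M c).1 - e.1, b) (loc M c))].
  have [m1 m2] := loc_lt N1 j a.
  elim=> [_|x d _ [c2 c1 c1k ax] /andP[Ed Ld] xd].
    rewrite blk_glue // loc_glue // subnn -ablk glueK; split=> //.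
      rewrite -[X in X < _]addn0 ltn_add2l lt0n; apply/negP => /eqP k0.
      by move: kE; rewrite k0 addn0 -surjective_pairing Ee.
    exact: conn_refl (conn_tgt pa).
  have d2 : (blk M d).2 = e.2.
    case: (emin _ Ed) => [lt|[-> //]].
    have /and4P[_ _ _] := xd; rewrite -{1}(glueK M x) -{1}(glueK M d) /= => h.
    have [l1 l2] := loc_lt N1 j x; case: (notop _ (conn_trans pa ax)).
    rewrite loc_glue //; by apply: (step_up l2 _ h); rewrite -c2 in lt.
  have d1 : e.1 <= (blk M d).1 by have := emin _ Ed; rewrite d2 ltnn => -[//|[]].
  have d1k : (blk M d).1 < e.1 + k.
    have := adj_blk M xd => /and4P[_ h _ _].
    have : (blk M d).1 <> e.1 + k; last by lia.
    by move=> dk; move: kE; rewrite -dk -d2 -surjective_pairing Ed.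
  split=> //; apply: conn_step ax _ _.
    rewrite LE; apply: glue_inflate => //; apply: full.
    have [] := EK Ed; lia.
  rewrite /= in c1 c2 d1 d2.
  move: xd; rewrite -{1}(glueK M x) -{1}(glueK M d) /adj /= c2 d2.
  have [u eu] : exists u, x.1 %/ M = e.1 + u by exists (x.1 %/ M - e.1); lia.
  have [v ev] : exists v, d.1 %/ M = e.1 + v by exists (d.1 %/ M - e.1); lia.
  by rewrite eu ev !addKn !mulnDl -!addnA -!addnS !leq_add2l.
apply: none; exists (0, b); first by apply: full; exact: expN_gt0.
right=> r Lr; apply: conn_trans pa _.
have [r1 r2] := level_inbox N1 Lr.
have : conn (inflate M E (L j)) (glue M e (loc M a)) (glue M e r).
  by apply: Econn; apply: glue_inflate.
by move=> /run[_ _ _]; rewrite blk_glue // loc_glue // subnn.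
Qed.

(** Label each component by a block of level [n] and the alternative of [top_or_block] that holds.
    Labels are injective: two components filling one block share its cells, and two touching its top
    are joined inside it by [top_conn]. *)
Lemma hcross_bound j s : uniq s -> {in s, forall p, L (n + j) p} ->
  {in s &, forall p q, conn (L (n + j)) p q -> p = q} ->
  {in s, forall p, hcross (N ^ (n + j)) (L (n + j)) p} ->
  size s <= 2 * (N ^ n * N ^ n).
Proof.
move=> us sL sinj sh; case: s us sL sinj sh => [//|p0 s0]; set s := p0 :: s0.
move=> us sL sinj sh.
have p0s : p0 \in s by rewrite mem_head.
have allH := hcross_all (sL _ p0s) (sh _ p0s).
(* The crossing of [p0] is coarsened from level [n + j] to level [j]. *)
have allHj : forall q, L j q -> hcross (N ^ j) (L j) q.
  have := sh _ p0s; rewrite addnC => /hcross_blk; apply: hcross_all.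
  by have := sL _ p0s; rewrite addnC (levelD N D j n) => /andP[].
have [r0 Lr0] : exists r, L j r.
  by exists (loc (N ^ j) p0); have := sL _ p0s; rewrite (levelD N D n j) => /andP[].
have /choice [w wP] (p : cell) : exists et : cell * bool, p \in s ->
    L n et.1 /\ if et.2 then forall r, L j r -> conn (L (n + j)) p (glue (N ^ j) et.1 r)
    else exists r, [/\ L j r, r.2 = (N ^ j).-1 &
                       conn (L (n + j)) p (glue (N ^ j) et.1 r)].
  have [ps|] := boolP (p \in s); last by exists (p, true).
  by have [e Le [h|h]] := top_or_block allH (sL _ ps);
    [exists (e, false)|exists (e, true)].
have winj : {in s &, injective w}.
  move=> p q ps qs pq; apply: sinj => //.
  have [Lp] := wP _ ps; have [Lq] := wP _ qs; rewrite -pq; case: (w p).2.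
    by move=> hq hp; apply: conn_trans (hp _ Lr0) (conn_sym (hq _ Lr0)).
  move=> [r [Lr rT qr]] [r' [Lr' r'T pr']].
  apply: conn_trans pr' (conn_trans _ (conn_sym qr)).
  apply: conn_eq (fun x => esym (levelD N D n j x)) _; apply: conn_glue => //.
  exact: top_conn (@level_inbox N D N1 j) allHj Lr' Lr r'T rT.
rewrite -(size_map w).
pose box := [seq (x, y) | x <- iota 0 (N ^ n), y <- iota 0 (N ^ n)].
have -> : 2 * (N ^ n * N ^ n) = size [seq (e, t) | e <- box, t <- [:: true; false]].
  by rewrite !size_allpairs !size_iota mulnC.
apply: uniq_leq_size; first by rewrite map_inj_in_uniq.
move=> _ /mapP[p ps ->]; have [Lw _] := wP _ ps.
have [w1 w2] := level_inbox N1 Lw.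
rewrite [w p]surjective_pairing; apply/allpairsP; exists (w p); split=> //.
  rewrite [(w p).1]surjective_pairing; apply/allpairsP; exists (w p).1.
  by rewrite !mem_iota.
by case: (w p).2.
Qed.
End Core.

(** If [E] is a single cell, level [n + j] is connected; otherwise, by [cross], [hcross_bound]
    applies to the levels or to their transposes. *)
Lemma level_bound N D E n : 1 < N -> inbox (N ^ n) E -> (exists e, E e) ->
  (forall j p q,
    inflate (N ^ j) E (level N D j) p -> inflate (N ^ j) E (level N D j) q ->
    conn (inflate (N ^ j) E (level N D j)) p q) ->
  forall j s, uniq s -> {in s, forall p, level N D (n + j) p} ->
  {in s &, forall p q, conn (level N D (n + j)) p q -> p = q} ->
  size s <= 2 * (N ^ n * N ^ n).
Proof.
move=> N1 EK Ene Econn j s us sL sinj.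
have [->//|[p0 p0s]] : s = [::] \/ exists p, p \in s.
  by case: (s) => [|p ?]; [left|right; exists p; rewrite mem_head].
have Lp0 := sL _ p0s.
have [Emany|] := pselect (forall e, E e -> exists2 e', E e' & e' <> e); last first.
  move=> /existsNP[e /not_implyP[Ee]] /forall2NP e1.
  have all_conn p q : level N D (n + j) p -> level N D (n + j) q ->
      conn (level N D (n + j)) p q.
    move=> Lp Lq; set M := N ^ (n + j).
    have := Econn _ _ _ (glue_inflate N1 Ee Lp) (glue_inflate N1 Ee Lq).
    have [? ?] := level_inbox N1 Lp; have [? ?] := level_inbox N1 Lq.
    have Ee1 x : E x -> x = e by move=> Ex; case: (e1 x) => // /contrapT.
    move=> /(@conn_map _ (level N D (n + j)) (loc M)); rewrite !loc_glue //; apply.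
      by move=> x /andP[].
    move=> x y /andP[/Ee1 ex _] /andP[/Ee1 ey _].
    by rewrite -{1}(glueK M x) -{1}(glueK M y) ex ey adj_glue.
  have : size s <= size [:: p0].
    apply: uniq_leq_size => // p ps; rewrite inE; apply/eqP/sinj => //.
    by apply: all_conn => //; apply: sL.
  by move/leq_trans; apply; have := expN_gt0 N1 n; rewrite /=; nia.
have hv := cross N1 Econn Emany Ene EK.
have [hp0|vp0] := hv _ _ Lp0.
  apply: (hcross_bound N1 Econn Emany Ene EK us sL sinj) => p ps.
  by apply: (hcross_all N1 Econn Emany Ene EK Lp0) => //; apply: sL.
(* The component of [p0] joins bottom and top; exchanging the coordinates reduces to the previous
   case. *)
have tK : involutive transpose by case.
have Ltr i p : level N (D \o transpose) i p = level N D i (transpose p).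
  exact: level_transpose.
have ctr i p q : conn (level N D i) p q <->
    conn (level N (D \o transpose) i) (transpose p) (transpose q).
  split=> /conn_transpose; last rewrite !tK;
    by apply: conn_eq => x /=; rewrite Ltr ?tK.
rewrite -(size_map transpose).
have Etr : forall i p q,
    inflate (N ^ i) (E \o transpose) (level N (D \o transpose) i) p ->
    inflate (N ^ i) (E \o transpose) (level N (D \o transpose) i) q ->
    conn (inflate (N ^ i) (E \o transpose) (level N (D \o transpose) i)) p q.
  move=> i p q; have e x : inflate (N ^ i) (E \o transpose) (level N (D \o transpose) i) x
      = inflate (N ^ i) E (level N D i) (transpose x).
    by rewrite /inflate /= Ltr.
  rewrite !e => Ep Eq; have := conn_transpose (Econn _ _ _ Ep Eq); rewrite !tK.
  by apply: conn_eq => x /=; rewrite e.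
have Emt e : (E \o transpose) e -> exists2 e', (E \o transpose) e' & e' <> e.
  move=> /Emany[e' Ee' ne]; exists (transpose e'); first by rewrite /= tK.
  by move=> te; apply: ne; rewrite -te tK.
have Ent : exists e, (E \o transpose) e.
  by case: Ene => e Ee; exists (transpose e); rewrite /= tK.
have EKt : inbox (N ^ n) (E \o transpose) by move=> e /EK[].
have hp0 : hcross (N ^ (n + j)) (level N (D \o transpose) (n + j)) (transpose p0).
  case: vp0 => a [b [/ctr pa /ctr pb aB bT]].
  by exists (transpose a), (transpose b).
have sLt : {in map transpose s, forall p, level N (D \o transpose) (n + j) p}.
  by move=> _ /mapP[p ps ->]; rewrite Ltr tK; apply: sL.
apply: (hcross_bound N1 Etr Emt Ent EKt _ sLt).
- by rewrite map_inj_uniq //; apply: can_inj tK.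
- move=> _ _ /mapP[p ps ->] /mapP[q qs ->] /ctr pq; congr transpose; exact: sinj.
- move=> p /sLt Lp; apply: (hcross_all N1 Etr Emt Ent EKt _ hp0) => //.
  by rewrite Ltr tK.
Qed.

(** * Tiles of the fractal square and its components *)

Section Topology.
Local Open Scope classical_set_scope.
Local Open Scope ring_scope.

(** A point outside some [U i] has a neighbourhood missing all later [U j]; compactness gives a
    common index. With [O] empty this is Cantor's intersection theorem. *)
Lemma compact_nested (T : topologicalType) (K O : set T) (U : nat -> set T) :
  compact K -> (forall i j, (i <= j)%N -> U j `<=` U i) ->
  (forall i, closed (U i)) ->
  (forall z, K z -> (forall i, U i z) -> nbhs z O) ->
  exists i, K `&` U i `<=` O.
Proof.
move=> /compact_near_coveringP cK Udec Ucl UO.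
have /cK [] : forall z, K z -> \forall z' \near z & i \near \oo, U i z' -> O z'.
  move=> z Kz; have [Uz|/existsNP[i Uiz]] := pselect (forall i, U i z).
    by exists (O, setT) => [|[z' i] [Oz' _] _ //]; split; [exact: UO|exact: filterT].
  exists (~` U i, [set j | (i <= j)%N]).
    split; last by exists i.
    by apply: open_nbhs_nbhs; split=> //; rewrite openC.
  by move=> [z' j] /= [nU ij] /(Udec _ _ ij).
move=> i _ h; exists i => z [Kz Uz]; exact: (h i (leqnn i) z Kz Uz).
Qed.

Lemma compact_closed_gap (R : realType) (T : pseudoMetricType R) (B C : set T) :
  compact B -> closed C -> B `&` C = set0 ->
  exists2 e : R, 0 < e & forall b c, B b -> C c -> ~ ball b e c.
Proof.
move=> /compact_near_coveringP cB cC BC.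
have H : forall b, B b ->
    \forall b' \near b & e \near (0:R)^'+, forall c, C c -> ~ ball b' e c.
  move=> b Bb; have /nbhs_ballP[r /= r0 rC] : nbhs b (~` C).
    apply: open_nbhs_nbhs; split; first by rewrite openC.
    by move=> Cb; have : (B `&` C) b by []; rewrite BC.
  have r20 : 0 < r / 2 by rewrite divr_gt0.
  exists (ball b (r / 2), [set e | e < r / 2]).
    by split; [exact: nbhsx_ballx|exact: nbhs_right_lt].
  move=> [b' e] /= [bb' er] c Cc b'c; apply: rC Cc.
  by rewrite [r]splitr; apply: ball_triangle bb' (le_ball (ltW er) b'c).
have : \forall e \near (0:R)^'+, 0 < e /\ forall b, B b -> forall c, C c -> ~ ball b e c.
  by apply: filterI; [exact: nbhs_right_gt|exact: cB H].
by move=> /filter_ex[e [e0 he]]; exists e => // b c Bb; exact: he.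
Qed.

End Topology.

Section FractalSquare.
Local Open Scope classical_set_scope.
Local Open Scope ring_scope.
Variables (R : realType) (N : nat) (N1 : (1 < N)%N) (D0 : {set 'I_N * 'I_N}).
Variables (F : set (R * R)) (hF : is_fractal_square D0 F).

Definition digits : pred cell :=
  fun p => [exists d in D0, (d.1 == p.1 :> nat) && (d.2 == p.2 :> nat)].
Notation L := (level N digits).

(* The affine map from the square of level [n] at [p] onto the unit square. *)
Definition zoom (n : nat) (p : cell) (z : R * R) : R * R :=
  ((N ^ n)%:R * z.1 - p.1%:R, (N ^ n)%:R * z.2 - p.2%:R).
Definition tile (n : nat) (p : cell) : set (R * R) := [set z | F (zoom n p z)].

Let N0 : (N%:R : R) != 0. Proof. by rewrite pnatr_eq0; lia. Qed.
Let Nn0 n : (0 : R) < (N ^ n)%:R. Proof. by rewrite ltr0n; exact: expN_gt0. Qed.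

Lemma zoom_zoom m n p q z :
  zoom m q (zoom n p z) = zoom (n + m) (glue (N ^ m) p q) z.
Proof.
rewrite /zoom /glue /= expnD !natrM !natrD !natrM.
by congr pair; ring.
Qed.

Lemma fs_digit z : F z <->
  exists d, [/\ digits d, (d.1 < N)%N, (d.2 < N)%N & F (zoom 1 d z)].
Proof.
case: hF => _ _ FE.
split=> [|[d [/existsP[d0 /andP[dD /andP[/eqP d1 /eqP d2]]] _ _ Fd]]].
  rewrite {1}FE => -[d dD [y Fy <-]].
  exists (d.1 : nat, d.2 : nat); split=> //=.
    by apply/existsP; exists d; rewrite /= !eqxx !andbT.
  suff -> : zoom 1 (d.1 : nat, d.2 : nat) (fs_map d y) = y by [].
  by rewrite /zoom /fs_map /= expn1; case: (y) => a b /=; congr pair; field.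
rewrite FE; exists d0 => //; exists (zoom 1 d z) => //.
rewrite /zoom /fs_map /= expn1 d1 d2; case: (z) => a b /=; congr pair; field => //.
Qed.

Lemma fs_level n z : F z <-> exists2 p, L n p & tile n p z.
Proof.
elim: n z => [|n IH] z.
  have zE : zoom 0 (0%N, 0%N) z = z.
    by case: z => a b; rewrite /zoom /= expn0 !mul1r !subr0.
  split=> [Fz|[p /eqP ->]]; last by rewrite /tile /= zE.
  by exists (0%N, 0%N) => //; rewrite /tile /= zE.
split=> [/IH[p Lp /fs_digit[d [Dd d1 d2]]]|[p /andP[Lp Dp] Tp]].
  rewrite zoom_zoom addn1 expn1 => Fd; exists (glue N p d) => //=.
  by rewrite /inflate blk_glue // loc_glue // Lp.
apply/IH; exists (blk N p) => //; apply/fs_digit; exists (loc N p).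
by rewrite !ltn_pmod ?zoom_zoom ?expn1 ?addn1 ?glueK //; lia.
Qed.

Lemma tile_sub n p : L n p -> tile n p `<=` F.
Proof. by move=> Lp z Tz; apply/(fs_level n); exists p. Qed.

Lemma tile_refine n j p z : tile n p z <->
  exists2 r, L j r & tile (n + j) (glue (N ^ j) p r) z.
Proof.
split=> [/(fs_level j)[r Lr]|[r Lr Tr]].
  by rewrite /tile /= zoom_zoom; exists r.
by apply/(fs_level j); exists r => //; rewrite /tile /= zoom_zoom.
Qed.

Lemma tile_coarse n j p z : L (n + j) p -> tile (n + j) p z -> tile n (blk (N ^ j) p) z.
Proof.
rewrite levelD => /andP[_ Lr] Tz.
by apply/(tile_refine n j); exists (loc (N ^ j) p) => //; rewrite glueK.
Qed.

Lemma tile_nonempty n p : exists z, tile n p z.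
Proof.
case: hF => -[w Fw] _ _.
exists ((w.1 + p.1%:R) / (N ^ n)%:R, (w.2 + p.2%:R) / (N ^ n)%:R).
rewrite /tile /zoom /=.
have H : forall a b : R, (N ^ n)%:R * ((a + b) / (N ^ n)%:R) - b = a.
  by move=> a b; rewrite mulrC divfK ?addrK // gt_eqF.
by rewrite !H; case: w Fw.
Qed.

(** At each level [n] some [zoom n p z] lies in the bounded set [F], so the coordinates of
    [N ^ n * z] stay within a constant of [[0, N ^ n]]; [n] is then taken large. *)
Lemma fs_unit z : F z -> (0 <= z.1 <= 1) /\ (0 <= z.2 <= 1).
Proof.
move=> Fz; have [B hB] : exists B : R, forall y, F y -> `|y.1| <= B /\ `|y.2| <= B.
  case: hF => _ /compact_bounded[B [_ hB]] _; exists (B + 1) => y Fy.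
  have := hB (B + 1); rewrite ltrDl ltr01 => /(_ isT y Fy) /=.
  by rewrite prod_normE ge_max => /andP[].
have B0 : 0 <= B by apply: le_trans (hB _ Fz).1; exact: normr_ge0.
have H (x : R) :
    (forall n, exists2 k, (k < N ^ n)%N & `|(N ^ n)%:R * x - k%:R| <= B) ->
    0 <= x <= 1.
  move=> hx; have small e : 0 < e -> exists n, B < e * (N ^ n)%:R.
    move=> e0; exists (Num.trunc (B / e)).+1.
    rewrite -ltr_pdivrMl // mulrC.
    apply: (@lt_trans _ _ ((Num.trunc (B / e)).+1%:R)).
      by rewrite truncnS_gt.
    by rewrite ltr_nat ltn_expl.
  apply/andP; split; rewrite leNgt; apply/negP => x0.
    have [|n hn] := small (- x); first by rewrite oppr_gt0.
    have [k _] := hx n; rewrite ler_norml => /andP[h _].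
    have : (0:R) <= k%:R by rewrite ler0n.
    by nra.
  have [|n hn] := small (x - 1); first by rewrite subr_gt0.
  have [k kN] := hx n; rewrite ler_norml => /andP[_ h].
  have : k%:R <= (N ^ n)%:R :> R by rewrite ler_nat ltnW.
  by nra.
split; apply: H => n; have /(fs_level n)[p Lp Tp] := Fz;
  have [p1 p2] := level_inbox N1 Lp.
  by exists p.1 => //; case: (hB _ Tp).
by exists p.2 => //; case: (hB _ Tp).
Qed.

Lemma tile_adj n p q z : tile n p z -> tile n q z -> adj p q.
Proof.
move=> /fs_unit[/= /andP[a1 a2] /andP[a3 a4]] /fs_unit[/= /andP[b1 b2] /andP[b3 b4]].
have H (a b : nat) : (a%:R : R) <= b%:R + 1 -> (a <= b.+1)%N.
  by rewrite natr1 ler_nat.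
apply/and4P; split; apply: H; lra.
Qed.

Lemma ball_tile n p q z z' e : adj p q -> tile n p z -> tile n q z' ->
  2 < e * (N ^ n)%:R -> ball z e z'.
Proof.
move=> /and4P[p1 p2 p3 p4].
move=> /fs_unit[/= /andP[a1 a2] /andP[a3 a4]] /fs_unit[/= /andP[b1 b2] /andP[b3 b4]] he.
have H (a b : nat) : (a <= b.+1)%N -> (a%:R : R) <= b%:R + 1.
  by rewrite natr1 ler_nat.
have := H _ _ p1; have := H _ _ p2; have := H _ _ p3; have := H _ _ p4 => h1 h2 h3 h4.
have K (x y : R) : `|(N ^ n)%:R * (x - y)| <= 2 -> `|x - y| < e.
  rewrite normrM gtr0_norm ?Nn0 // => h; rewrite -(ltr_pM2l (Nn0 n)).
  by rewrite [X in _ < X]mulrC; exact: le_lt_trans he.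
split; rewrite -ball_normE /ball_ /=; apply: K; rewrite mulrBr ler_norml; lra.
Qed.

Lemma closed_tile n p : closed (tile n p).
Proof.
case: hF => _ Fc _; apply: preimage_closed.
  move=> z _; rewrite /zoom.
  have H (f : R * R -> R) (b : R) : f w @[w --> z] --> f z ->
      ((N ^ n)%:R * f w - b : R) @[w --> z] --> ((N ^ n)%:R * f z - b : R).
    by move=> fz; apply: cvgB; [apply: cvgM => //; exact: cvg_cst|exact: cvg_cst].
  by apply: (cvg_pair (H fst _ cvg_fst) (H snd _ cvg_snd)).
exact: (compact_closed (@norm_hausdorff _ _) Fc).
Qed.

End FractalSquare.

(** * Components of the fractal square as limits of components of the levels *)

Section Components.
Local Open Scope classical_set_scope.
Local Open Scope ring_scope.
Variables (R : realType) (N : nat) (N1 : (1 < N)%N) (D0 : {set 'I_N * 'I_N}).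
Variables (F : set (R * R)) (hF : is_fractal_square D0 F).
Notation L := (level N (digits D0)).
Notation tile := (tile N F).

(** For points of [F]: lying in the same component of the union of the level [n] squares. *)
Definition linked (n : nat) (x y : R * R) :=
  exists p q, [/\ tile n p x, tile n q y & conn (L n) p q].

Lemma linked_refl n x : F x -> linked n x x.
Proof.
move=> /(fs_level N1 hF n)[p Lp Tp]; exists p, p.
by split=> //; exact: conn_refl.
Qed.

Lemma linked_sym n x y : linked n x y -> linked n y x.
Proof. by move=> [p [q [? ? ?]]]; exists q, p; split=> //; exact: conn_sym. Qed.

Lemma linked_conn n x y p q : linked n x y ->
  L n p -> tile n p x -> L n q -> tile n q y ->
  conn (L n) p q.
Proof.
move=> [p' [q' [Tp' Tq' pq]]] Lp Tp Lq Tq.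
have pp' : conn (L n) p p'.
  by apply: conn_adj Lp (conn_src pq) (tile_adj N1 hF Tp Tp').
have qq' : conn (L n) q' q.
  by apply: conn_adj (conn_tgt pq) Lq (tile_adj N1 hF Tq' Tq).
exact: conn_trans pp' (conn_trans pq qq').
Qed.

Lemma linked_trans n x y z : linked n x y -> linked n y z -> linked n x z.
Proof.
move=> [p [q [Tp Tq pq]]] [q' [r [Tq' Tr qr]]]; exists p, r; split=> //.
by apply: conn_trans (qr); apply: conn_step pq (conn_src qr) (tile_adj N1 hF Tq Tq').
Qed.

Lemma linked_F n x y : linked n x y -> F y.
Proof. by move=> [p [q [_ Tq /conn_tgt Lq]]]; exact: (tile_sub N1 hF Lq Tq). Qed.

Lemma linked_le m n x y : (m <= n)%N -> linked n x y -> linked m x y.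
Proof.
move=> /subnKC <-; set j := (n - m)%N => -[p [q [Tp Tq pq]]].
exists (blk (N ^ j) p), (blk (N ^ j) q); split.
- exact: (tile_coarse N1 hF (conn_src pq) Tp).
- exact: (tile_coarse N1 hF (conn_tgt pq) Tq).
- exact: conn_blk (conn_eq (levelD N (digits D0) m j) pq).
Qed.

Lemma finite_level n (A : set cell) : A `<=` [set p | L n p] -> finite_set A.
Proof.
move=> AL.
apply: (sub_finite_set _ (finite_setX (finite_II (N ^ n)) (finite_II (N ^ n)))).
by move=> p /AL /(level_inbox N1)[].
Qed.

Lemma closed_linked n x : closed (linked n x).
Proof.
pose A : set cell := [set q | exists2 p, tile n p x & conn (L n) p q].
have -> : linked n x = \bigcup_(q in A) tile n q.
  apply/seteqP; split=> [y [p [q [? ? ?]]]|y [q [p ? ?] ?]]; last by exists p, q.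
  by exists q => //; exists p.
apply: closed_bigcup => [|q _]; last exact: (closed_tile hF).
by apply: (@finite_level n) => q [p _ /conn_tgt].
Qed.

(** Like the class of [x], its complement in [F] is a finite union of tiles; hence the class is both
    open and closed in [F]. *)
Lemma closed_unlinked n x : closed (F `\` linked n x).
Proof.
pose A : set cell := [set q | L n q /\ ~ exists2 p, tile n p x & conn (L n) p q].
have -> : F `\` linked n x = \bigcup_(q in A) tile n q.
  apply/seteqP; split=> [y [/(fs_level N1 hF n)[q Lq Tq] nl]|y [q [Lq nq] Tq]].
    by exists q => //; split=> // -[p Tp pq]; apply: nl; exists p, q.
  split; first exact: (tile_sub N1 hF Lq Tq).
  move=> [p [q' [Tp Tq' pq']]]; apply: nq; exists p => //.
  exact: conn_step pq' Lq (tile_adj N1 hF Tq' Tq).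
apply: closed_bigcup => [|q _]; last exact: (closed_tile hF).
by apply: (@finite_level n) => q [].
Qed.

Lemma component_linked n x : F x -> connected_component F x `<=` linked n x.
Proof.
move=> Fx; set C := connected_component F x.
have CF : C `<=` F by exact: connected_component_sub.
suff <- : C `&` linked n x = C by exact: subIsetr.
apply: (@component_connected _ F x).
- by exists x; split; [exact: connected_component_refl|exact: linked_refl].
- exists (~` (F `\` linked n x)); first by rewrite openC; exact: closed_unlinked.
  apply/seteqP; split=> y [Cy h]; split=> //; first by move=> [].
  by apply: contrapT => nl; apply: h; split=> //; exact: CF.
- by exists (linked n x) => //; exact: closed_linked.
Qed.

Lemma expn_large (e : R) : 0 < e ->
  exists n0, forall n, (n0 <= n)%N -> 2 < e * (N ^ n)%:R.
Proof.
move=> e0; exists (Num.trunc (2 / e)).+1 => n hn.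
rewrite -ltr_pdivrMl // mulrC; apply: (@lt_trans _ _ (n%:R)).
  by apply: lt_le_trans (truncnS_gt _) _; rewrite ler_nat.
by rewrite ltr_nat ltn_expl.
Qed.

(** The set [Q] of points linked to [x] at all levels is connected: were it split into two closed
    parts, a positive gap would separate them, yet at a fine level a chain of small tiles, all close
    to [Q], joins one part to the other. *)
Lemma linked_component x y : F x -> (forall n, linked n x y) -> connected_component F x y.
Proof.
move=> Fx xy; pose Q := [set z | forall n, linked n x z].
suff Qc : connected Q.
  apply: (@connected_component_max _ F Q) => //; first by move=> n; exact: linked_refl.
  by move=> z /(_ 0%N)/linked_F.
have clQ : closed Q.
  rewrite (_ : Q = \bigcap_n linked n x).
    by apply: closed_bigI => n _; exact: closed_linked.
  by apply/seteqP; split=> z h n; [move=> _|]; exact: h.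
have cF : compact F by case: hF.
have QF : Q `<=` F by move=> z /(_ 0%N)/linked_F.
move=> B [b0 Bb0] [V oV BV] [C cC BC]; apply: contrapT => BQ.
have BsQ : B `<=` Q by rewrite BC; exact: subIsetl.
have [c [Qc nBc]] : exists c, Q c /\ ~ B c.
  by apply: contrapT => /forallNP h; apply: BQ; apply/seteqP; split=> // z Qz;
     apply: contrapT => nB; apply: (h z).
have cB : compact B.
  by apply: subclosed_compact cF _; [rewrite BC; exact: closedI|exact: subset_trans QF].
have clQB : closed (Q `\` B).
  rewrite (_ : Q `\` B = Q `&` ~` V); first by apply: closedI => //; exact: open_closedC.
  apply/seteqP; split=> z [Qz h]; split=> //; first by move=> Vz; apply: h; rewrite BV.
  by rewrite BV => -[].
have [|e e0 gap] := compact_closed_gap cB clQB.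
  by apply/seteqP; split=> // z [? []].
pose d := e / 4; have d0 : 0 < d by rewrite divr_gt0.
have [n0 hn0] : exists n, F `&` linked n x `<=` [set z | exists2 w, Q w & ball w d z].
  apply: (compact_nested cF) => [i j ij z|i|z Fz Qz].
  - exact: linked_le.
  - exact: closed_linked.
  - by apply/nbhs_ballP; exists d => //= w zw; exists z => //.
have [n1 hn1] := expn_large d0.
pose n := maxn n0 n1; have large := hn1 n (leq_maxr _ _).
have near z : linked n x z -> exists2 w, Q w & ball w d z.
  move=> xz; apply: hn0; split; first exact: linked_F xz.
  exact: linked_le (leq_maxl _ _) xz.
have [p [q [Tp Tq pq]]] : linked n b0 c.
  by apply: linked_trans (Qc n); apply: linked_sym; exact: BsQ.
have xb0 : linked n x b0 by exact: BsQ.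
(* Along the chain a point of [B] stays within [d] of the current tile: the next point of [Q] is
   within [3 * d < e] of it, so the gap keeps that point in [B]. *)
have [b [w [Bb Tw bw]]] : exists b w, [/\ B b, tile n q w & ball b d w].
  elim: pq => [Lp|q1 q2 pq1 [b [z [Bb Tz bz]]] Lq2 q12].
    by exists b0, b0; split=> //; exact: ballxx.
  have [z' Tz'] := tile_nonempty N1 hF n q2.
  have [w Qw wz'] : exists2 w, Q w & ball w d z'.
    apply: near; apply: linked_trans xb0 _; exists p, q2; split=> //.
    exact: conn_step pq1 Lq2 q12.
  exists w, z'; split=> //; apply: contrapT => nBw; apply: (gap b w) => //.
  have zz' := ball_tile N1 hF q12 Tz Tz' large.
  have h := ball_triangle (ball_triangle bz zz') (ball_sym wz').
  by apply: le_ball h; rewrite /d; lra.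
apply: (gap b c) => //.
have wc := ball_tile N1 hF (adj_refl q) Tw Tq large.
by apply: le_ball (ball_triangle bw wc); rewrite /d; lra.
Qed.

End Components.

(** * From countably many components to finitely many *)

Section Count.
Local Open Scope classical_set_scope.
Variables (R : realType) (N : nat) (N1 : (1 < N)%N) (D0 : {set 'I_N * 'I_N}).
Variables (F : set (R * R)) (hF : is_fractal_square D0 F).
Notation L := (level N (digits D0)).
Notation tile := (tile N F).
Notation linked := (linked D0 F).
Notation cc := (connected_component F).

(** No level splits the level [n] class of [x], so this class is a component of [F]. *)
Definition isolated n x := F x /\ forall m y, linked n x y -> linked m x y.

Lemma conn_inflate n j (E : pred cell) p q :
  (forall e, E e -> L n e) ->
  (forall e e', E e -> L n e' -> adj e e' -> E e') ->
  E (blk (N ^ j) p) -> conn (L (n + j)) p q ->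
  conn (inflate (N ^ j) E (L j)) p q.
Proof.
move=> EL Eadj Ep; elim=> [|a b ab IH Lb]; last move=> adjab.
  by rewrite levelD => /andP[_ Lp]; apply: conn_refl; rewrite /inflate Ep.
move: Lb; rewrite levelD => /andP[Lb1 Lb2].
apply: (conn_step IH) => //; rewrite /inflate Lb2 andbT.
by have /andP[Ea _] := conn_tgt IH; apply: Eadj Ea Lb1 (adj_blk _ adjab).
Qed.

(** [E] collects the cells of level [n] joined to [x]. Any two cells of [inflate (N ^ j) E (L j)]
    contain points linked to [x], hence to each other at level [n + j]; the joining walk stays over
    [E], so [level_bound] applies. *)
Lemma isolated_bound n x : isolated n x -> exists k, forall j s, uniq s ->
  {in s, forall p, L (n + j) p} ->
  {in s &, forall p q, conn (L (n + j)) p q -> p = q} -> size s <= k.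
Proof.
move=> [Fx iso]; exists (2 * (N ^ n * N ^ n)).
pose E : pred cell := fun e => `[< exists2 p, tile n p x & conn (L n) p e >].
have EL e : E e -> L n e by move=> /asboolP[p _ /conn_tgt].
have Eadj e e' : E e -> L n e' -> adj e e' -> E e'.
  move=> /asboolP[p Tp pe] Le' ee'; apply/asboolP; exists p => //.
  exact: conn_step pe Le' ee'.
have link j p : inflate (N ^ j) E (L j) p ->
    L (n + j) p /\ exists2 y, tile (n + j) p y & linked n x y.
  move=> /andP[Ep Lp].
  have Lnp : L (n + j) p by rewrite levelD /inflate EL.
  split=> //; have [y Ty] := tile_nonempty N1 hF (n + j) p.
  exists y => //; move: Ep => /asboolP[q Tq qp]; exists q, (blk (N ^ j) p).
  by split=> //; exact: (tile_coarse N1 hF Lnp Ty).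
apply: level_bound => // [e /EL Le||j p q Ep Eq].
- exact: (level_inbox N1 Le).
- have /(fs_level N1 hF n)[p Lp Tp] := Fx; exists p; apply/asboolP.
  by exists p => //; exact: conn_refl.
have [[Lp [y Ty xy]] [Lq [z Tz xz]]] := (link _ _ Ep, link _ _ Eq).
apply: (conn_inflate EL Eadj); first by case/andP: Ep.
apply: (linked_conn N1 hF _ Lp Ty Lq Tz).
exact: (linked_trans N1 hF (linked_sym (iso _ _ xy)) (iso _ _ xz)).
Qed.

(** Among [k + 1] components each pair is separated at some level; at a common finer level the cells
    through chosen points are pairwise unconnected, against the bound. *)
Lemma finite_of_bound n k : (forall j s, uniq s ->
  {in s, forall p, L (n + j) p} ->
  {in s &, forall p q, conn (L (n + j)) p q -> p = q} -> size s <= k) ->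
  finite_set (components F).
Proof.
move=> bound; apply: contrapT => /(@infinite_set_fset _ _ k.+1)[A AC kA].
have [B [uB BC kB]] : exists B : seq (set (R * R)),
    [/\ uniq B, {in B, forall K, components F K} & k < size B].
  by exists (finmap.enum_fset A); split=> //; exact: finmap.fset_uniq.
move: kB; apply/negP; rewrite -leqNgt.
have /choice[pt ptP] (K : set (R * R)) :
    exists x : R * R, components F K -> F x /\ cc x = K.
  have [[x Fx <-]|] := pselect (components F K); first by exists x.
  by exists (0%R, 0%R).
have /choice[lv lvP] (KK : set (R * R) * set (R * R)) : exists m,
    components F KK.1 -> components F KK.2 -> KK.1 <> KK.2 ->
    ~ linked m (pt KK.1) (pt KK.2).
  have [[C1 [C2 C12]]|nC] :=
    pselect (components F KK.1 /\ components F KK.2 /\ KK.1 <> KK.2).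
    have [F1 e1] := ptP _ C1; have [F2 e2] := ptP _ C2.
    have [h|/existsNP[m hm]] := pselect (forall m, linked m (pt KK.1) (pt KK.2));
      last by exists m.
    have /same_connected_component := linked_component N1 hF F1 h.
    by rewrite e1 e2 => /C12.
  by exists 0 => h1 h2 h3; case: nC.
pose m := \max_(K <- B) \max_(K' <- B) lv (K, K').
have lvm K K' : K \in B -> K' \in B -> lv (K, K') <= m.
  move=> KB K'B; rewrite /m (big_rem K) //= leq_max; apply/orP; left.
  by rewrite (big_rem K') //= leq_max leqnn.
have /choice[c cP] (K : set (R * R)) : exists p : cell, K \in B ->
    L (n + m) p /\ tile (n + m) p (pt K).
  have [KB|] := boolP (K \in B); last by exists (0, 0).
  have [Fx _] := ptP _ (BC _ KB).
  by have /(fs_level N1 hF (n + m))[p Lp Tp] := Fx; exists p.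
have cinj : {in B &, forall K K', conn (L (n + m)) (c K) (c K') -> K = K'}.
  move=> K K' KB K'B ckk; apply: contrapT => ne.
  apply: (lvP (K, K') (BC _ KB) (BC _ K'B) ne) => /=.
  apply: (linked_le N1 hF (n := n + m)).
    exact: leq_trans (lvm _ _ KB K'B) (leq_addl _ _).
  by exists (c K), (c K'); split=> //; [case: (cP _ KB)|case: (cP _ K'B)].
rewrite -(size_map c); apply: (bound m).
- rewrite map_inj_in_uniq // => K K' KB K'B e; apply: cinj => //.
  by rewrite -e; apply: conn_refl; case: (cP _ KB).
- by move=> _ /mapP[K KB ->]; case: (cP _ KB).
- move=> _ _ /mapP[K KB ->] /mapP[K' K'B ->] h; congr c; exact: cinj.
Qed.

(** Without isolated classes, each class contains a smaller one that avoids the component numbered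
    [i]. Iterating over [i] gives nested nonempty closed sets in the compact [F], and a common point
    would lie in a component that was avoided. *)
Lemma countable_isolated : countable (components F) -> exists n x, isolated n x.
Proof.
move=> /countable_injP[f finj]; apply: contrapT => noiso.
have split_ n x : F x -> exists m y, linked n x y /\ ~ linked m x y.
  move=> Fx; apply: contrapT => h; apply: noiso; exists n, x; split=> // m y xy.
  by apply: contrapT => nxy; apply: h; exists m, y.
pose T : Type := (nat * (R * R))%type.
have /choice[g gP] (ti : T * nat) : exists t' : T, F ti.1.2 ->
    [/\ F t'.2, linked t'.1 t'.2 `<=` linked ti.1.1 ti.1.2 &
        forall z, linked t'.1 t'.2 z -> f (cc z) <> ti.2].
  case: ti => -[n x] i /=.
  have [Fx|] := pselect (F x); last by exists (n, x).
  have [[z0 Fz0 fz0]|none] := pselect (exists2 z, F z & f (cc z) = i); last first.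
    by exists (n, x) => _; split=> // z /(linked_F N1 hF) Fz e; apply: none; exists z.
  have [m0 [y [xy nxy0]]] := split_ n x Fx; have Fy := linked_F N1 hF xy.
  pose m := maxn m0 n.
  have nxy : ~ linked m x y by move=> /(linked_le N1 hF (leq_maxl _ _)).
  (* It suffices to find a point of the class not linked to [z0] at level [m]; since [x] and [y] are
     separated there, one of them qualifies. *)
  have avoid x' : F x' -> linked n x x' -> ~ linked m z0 x' ->
      exists t' : T, F x -> [/\ F t'.2, linked t'.1 t'.2 `<=` linked n x &
        forall z, linked t'.1 t'.2 z -> f (cc z) <> i].
    move=> Fx' xx' nz; exists (m, x') => _ /=; split=> // z x'z.
      exact: (linked_trans N1 hF xx' (linked_le N1 hF (leq_maxr _ _) x'z)).
    move=> fz; apply: nz; have Fz := linked_F N1 hF x'z.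
    have e : cc z0 = cc z by apply: finj; rewrite ?inE ?fz //; [exists z0|exists z].
    apply: (linked_trans N1 hF _ (linked_sym x'z)).
    by apply: (component_linked N1 hF m Fz0); rewrite e; apply: connected_component_refl.
  have [zx|] := pselect (linked m z0 x);
    last by apply: avoid => //; exact: (linked_refl N1 hF).
  apply: (avoid y) => // zy; apply: nxy.
  exact: (linked_trans N1 hF (linked_sym zx) zy).
have [x0 Fx0] : F !=set0 by case: hF.
pose t := fix t i : T := if i is i'.+1 then g (t i', i') else (0, x0).
have tF i : F (t i).2 by elim: i => //= i IH; case: (gP (t i, i) IH).
pose U i := linked (t i).1 (t i).2.
have Udec i j : i <= j -> U j `<=` U i.
  elim: j => [|j IH]; first by rewrite leqn0 => /eqP ->.
  rewrite leq_eqVlt => /orP[/eqP -> //|]; rewrite ltnS => /IH ij.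
  by apply: subset_trans ij; case: (gP (t j, j) (tF j)).
have cF : compact F by case: hF.
have [i hi] : exists i, F `&` U i `<=` set0.
  apply: compact_nested => // [i|z Fz Uz]; first exact: (closed_linked N1 hF).
  (* The stage following index [f (cc z)] excludes [z] itself. *)
  have [_ _ /(_ z (Uz _.+1))] := gP (t (f (cc z)), f (cc z)) (tF _).
  by [].
by case: (hi (t i).2); split=> //; exact: (linked_refl N1 hF).
Qed.

End Count.

Theorem theorem1p7 (R : realType) (N : nat) (hN : (2 <= N)%N)
    (D : {set 'I_N * 'I_N}) (hD : D != finset.set0)
    (F : set (R * R)) (hF : is_fractal_square D F) :
  finite_set (components F) \/ ~ countable (components F).
Proof.
have [/(countable_isolated hN hF)[n [x iso]]|] := pselect (countable (components F));
  last by right.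
have [k bound] := isolated_bound hN hF iso.
by left; exact: (finite_of_bound hN hF bound).
Qed.
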